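(* The dagger category $\mathrm{TRel}(\mathbf{Sets}_\bullet,\mathrm{cp})$ of tame relations for the symmetric comparison cluster $\mathrm{cp}_X\colon\mathcal{L}(X)\otimes\mathcal{L}(X)\to 2$ in $\mathbf{Sets}_\bullet$, indexed by sets $X$ and given by $\mathrm{cp}_X(z\otimes z')=1$ iff $z=x=z'$ for some $x\in X$, is the category $\mathbf{PInj}$ of sets with partial injections between them: the morphisms $X\to Y$ are the relations $r\subseteq X\times Y$ satisfying both $$r(x,y)\text{ and }r(x,y')\Longrightarrow y=y'\qquad\text{and}\qquad r(x,y)\text{ and }r(x',y)\Longrightarrow x=x'.$$ That is, $r$ factors both as $X\to\mathcal{L}(Y)$ and as $Y\to\mathcal{L}(X)$.
   Context: $\mathbf{Sets}_\bullet$ is the category of pointed sets (sets with a base point $\bullet$) and base-point-preserving functions, with trivial (identity) involution, and symmetric monoidal closed via the tensor $\otimes$ (smash product) classifying functions that preserve the base point in each argument separately. $\mathcal{L}(X)=1+X=\{\bullet\}+X$ is the free pointed set on a set $X$, and $2=\mathcal{L}(1)=\{0,1\}$ with base point $0$ is the tensor unit. Maps $\widehat r\colon\mathcal{L}(X)\otimes\mathcal{L}(Y)\to 2$ in $\mathbf{Sets}_\bullet$ correspond bijectively to relations $r\subseteq X\times Y$, via $\widehat r(w\otimes z)=1$ iff $w=x\in X$, $z=y\in Y$ and $r(x,y)$. $\mathrm{TRel}(\mathbf{Sets}_\bullet,\mathrm{cp})$ has sets as objects. Morphisms $X\to Y$ are tame relations: maps $r\colon\mathcal{L}(X)\otimes\mathcal{L}(Y)\to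 2$ in $\mathbf{Sets}_\bullet$ for which there are (necessarily unique) pointed maps $r_*\colon\mathcal{L}(X)\to\mathcal{L}(Y)$ and $r^*\colon\mathcal{L}(Y)\to\mathcal{L}(X)$ with $\mathrm{cp}_Y\circ(r_*\otimes\mathrm{id})=r=\mathrm{cp}_X\circ(\mathrm{id}\otimes r^* )$. Identities are the $\mathrm{cp}_X$, composition is $s\bullet r=s\circ(r_*\otimes\mathrm{id})$, and the dagger is $r^\dagger=\mathrm{cp}_X\circ(r^*\otimes\mathrm{id})$. In $\mathbf{PInj}$ composition is relational composition and the dagger is relational converse. ''Is'' means isomorphic as dagger categories, identically on objects, via $r\leftrightarrow\widehat r$. ''Factors'' means that the function $X\to\mathcal{P}(Y)$ (resp. $Y\to\mathcal{P}(X)$) associated with $r$ takes values in subsets with at most one element, which are identified with elements of $\mathcal{L}(Y)$ (resp. $\mathcal{L}(X)$). *)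

(* Defs.v *)
From HB Require Import structures.
From mathcomp Require Import all_boot generic_quotient.
From mathcomp Require Import all_classical.

Set Implicit Arguments.
Unset Strict Implicit.
Unset Printing Implicit Defensive.

Local Open Scope classical_set_scope.
Local Open Scope quotient_scope.

Record pmap (A B : pointedType) : Type := PMap {
  pfun :> A -> B;
  pfun_point : pfun point = point }.

Lemma pmapP (A B : pointedType) (f g : pmap A B) : f =1 g -> f = g.
Proof.
case: f g => [f fp] [g gp] /= /funext fg; case: _ / fg in gp *.
by congr PMap; exact: Prop_irrelevance.
Qed.

Definition pid (A : pointedType) : pmap A A := @PMap A A id erefl.

Lemma pcomp_point (A B C : pointedType) (g : pmap B C) (f : pmap A B) :
  g (f point) = point.
Proof. by rewrite !pfun_point. Qed.

Definition pcomp (A B C : pointedType) (g : pmap B C) (f : pmap A B) :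
  pmap A C := @PMap A C (g \o f) (pcomp_point g f).

Lemma pcompE (A B C : pointedType) (g : pmap B C) (f : pmap A B) x :
  pcomp g f x = g (f x).
Proof. by []. Qed.

(* The smash product A * B / (A * {pt} \cup {pt} * B). *)
Section Smash.
Variables A B : pointedType.

Definition on_wedge (p : A * B) : bool := (p.1 == point) || (p.2 == point).

Definition smash_rel (p q : A * B) : bool :=
  (p == q) || (on_wedge p && on_wedge q).

Lemma smash_rel_refl : reflexive smash_rel.
Proof. by move=> p; rewrite /smash_rel eqxx. Qed.

Lemma smash_rel_sym : symmetric smash_rel.
Proof. by move=> p q; rewrite /smash_rel eq_sym andbC. Qed.

Lemma smash_rel_trans : transitive smash_rel.
Proof.
move=> q p r /orP[/eqP -> //|/andP[wp wq]] /orP[/eqP <-|/andP[_ wr]].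
  by rewrite /smash_rel wp wq orbT.
by rewrite /smash_rel wp wr orbT.
Qed.

Canonical smash_equiv :=
  EquivRel smash_rel smash_rel_refl smash_rel_sym smash_rel_trans.

Definition smash_type : Type := {eq_quot smash_equiv}.

HB.instance Definition _ := Choice.on smash_type.
HB.instance Definition _ :=
  isPointed.Build smash_type (\pi_{eq_quot smash_equiv} (point, point)).

Definition smash : pointedType := smash_type.

Definition tens (a : A) (b : B) : smash := \pi_{eq_quot smash_equiv} (a, b).

Lemma tens_wedge (a : A) (b : B) : on_wedge (a, b) -> tens a b = point.
Proof.
move=> w; apply/eqmodP; rewrite /= /smash_rel w orbC /=.
by rewrite /on_wedge /= eqxx.
Qed.

Lemma tens_pointl (b : B) : tens point b = point.
Proof. by apply: tens_wedge; rewrite /on_wedge /= eqxx. Qed.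

Lemma tens_pointr (a : A) : tens a point = point.
Proof. by apply: tens_wedge; rewrite /on_wedge /= eqxx orbT. Qed.

Lemma smashW (P : smash -> Prop) :
  (forall a b, P (tens a b)) -> forall t, P t.
Proof. by move=> Pt; elim/quotW => -[a b]; exact: Pt. Qed.

Record bipointed (C : pointedType) (h : A -> B -> C) : Prop := Bipointed {
  bipointedl : forall b, h point b = point;
  bipointedr : forall a, h a point = point }.

Section Lift.
Variables (C : pointedType) (h : A -> B -> C) (hP : bipointed h).

Definition smash_lift_fun (t : smash) : C :=
  let p := repr (t : {eq_quot smash_equiv}) in h p.1 p.2.

Lemma smash_lift_funE a b : smash_lift_fun (tens a b) = h a b.
Proof.
have wedge p : on_wedge p -> h p.1 p.2 = point.
  by case/orP => /eqP ->; rewrite ?(bipointedl hP) ?(bipointedr hP).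
rewrite /smash_lift_fun /tens.
have /eqmodP : repr (\pi_{eq_quot smash_equiv} (a, b)) = (a, b)
  %[mod {eq_quot smash_equiv}] by rewrite reprK.
case/orP => [/eqP -> //|/andP[w1 w2]].
by rewrite (wedge _ w1) -[RHS]/(h (a, b).1 (a, b).2) (wedge _ w2).
Qed.

Lemma smash_lift_point : smash_lift_fun point = point.
Proof. by rewrite smash_lift_funE (bipointedl hP). Qed.

Definition smash_lift : pmap smash C := PMap smash_lift_point.

Lemma smash_liftE a b : smash_lift (tens a b) = h a b.
Proof. exact: smash_lift_funE. Qed.

End Lift.

Lemma smash_mapP (C : pointedType) (f g : pmap smash C) :
  (forall a b, f (tens a b) = g (tens a b)) -> f = g.
Proof. by move=> fg; apply: pmapP; apply: smashW. Qed.

Lemma tens_universal (C : pointedType) (h : A -> B -> C) : bipointed h ->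
  exists! f : pmap smash C, forall a b, f (tens a b) = h a b.
Proof.
move=> hP; exists (smash_lift hP); split => [|g gE]; first exact: smash_liftE.
by apply: smash_mapP => a b; rewrite smash_liftE gE.
Qed.

End Smash.

Lemma tens_map_bipointed (A B A' B' : pointedType)
    (f : pmap A A') (g : pmap B B') :
  bipointed (fun a b => tens (f a) (g b)).
Proof.
by split => [b|a]; rewrite pfun_point ?tens_pointl ?tens_pointr.
Qed.

Definition tens_map (A B A' B' : pointedType) (f : pmap A A') (g : pmap B B') :
  pmap (smash A B) (smash A' B') := smash_lift (tens_map_bipointed f g).

Lemma tens_mapE (A B A' B' : pointedType) (f : pmap A A') (g : pmap B B') a b :
  tens_map f g (tens a b) = tens (f a) (g b).
Proof. exact: smash_liftE. Qed.

Lemma swap_bipointed (A B : pointedType) :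
  bipointed (fun (a : A) (b : B) => tens b a).
Proof. by split => x; rewrite ?tens_pointl ?tens_pointr. Qed.

Definition swap (A B : pointedType) : pmap (smash A B) (smash B A) :=
  smash_lift (@swap_bipointed A B).

Lemma swapE (A B : pointedType) (a : A) (b : B) :
  swap A B (tens a b) = tens b a.
Proof. exact: smash_liftE. Qed.

Record dagger_category (ob : Type) : Type := DaggerCategory {
  hom : ob -> ob -> Type;
  idm : forall X, hom X X;
  mcomp : forall X Y Z, hom Y Z -> hom X Y -> hom X Z;
  dag : forall X Y, hom X Y -> hom Y X;
  comp_idl : forall X Y (f : hom X Y), mcomp (idm Y) f = f;
  comp_idr : forall X Y (f : hom X Y), mcomp f (idm X) = f;
  compA : forall X Y Z W (h : hom Z W) (g : hom Y Z) (f : hom X Y),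
    mcomp h (mcomp g f) = mcomp (mcomp h g) f;
  dag_id : forall X, dag (idm X) = idm X;
  dag_comp : forall X Y Z (g : hom Y Z) (f : hom X Y),
    dag (mcomp g f) = mcomp (dag f) (dag g);
  dagK : forall X Y (f : hom X Y), dag (dag f) = f }.

Arguments hom {ob} d.
Arguments idm {ob} d.
Arguments mcomp {ob} d {X Y Z}.
Arguments dag {ob} d {X Y}.

(* Both categories have the same type of objects and the functor is the
   identity on them, so only its action on morphisms is recorded. *)
Record dagger_functor (ob : Type) (C D : dagger_category ob) : Type :=
  DaggerFunctor {
  fmor :> forall X Y, hom C X Y -> hom D X Y;
  fmor_id : forall X, fmor (idm C X) = idm D X;
  fmor_comp : forall X Y Z (g : hom C Y Z) (f : hom C X Y),
    fmor (mcomp C g f) = mcomp D (fmor g) (fmor f);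
  fmor_dag : forall X Y (f : hom C X Y),
    fmor (dag C f) = dag D (fmor f) }.

Arguments fmor {ob C D} d {X Y}.

(* In pointed sets the involution is trivial, so that a comparison map has the
   form obj i (x) obj i -> Omega.  [cp_inj] is monicity of the transpose
   obj i -> (obj i -o Omega) of cp_i. *)
Record symmetric_cluster (Omega : pointedType) (ob : Type) : Type :=
  SymmetricCluster {
  cl_obj : ob -> pointedType;
  cp : forall X, pmap (smash (cl_obj X) (cl_obj X)) Omega;
  cp_sym : forall X, pcomp (cp X) (swap (cl_obj X) (cl_obj X)) = cp X;
  cp_inj : forall (A : pointedType) X (f g : pmap A (cl_obj X)),
    pcomp (cp X) (tens_map f (pid _)) = pcomp (cp X) (tens_map g (pid _)) ->
    f = g }.

Section TameRelations.
Variables (Omega : pointedType) (ob : Type) (K : symmetric_cluster Omega ob).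

Local Notation obj := (cl_obj K).

(* [is_lower r f] says f = r_*, and [is_upper r g] says g = r^*; both are
   unique by [is_lower_inj] and [is_upper_inj]. *)
Definition is_lower X Y (r : pmap (smash (obj X) (obj Y)) Omega)
    (f : pmap (obj X) (obj Y)) : Prop :=
  pcomp (cp K Y) (tens_map f (pid (obj Y))) = r.

Definition is_upper X Y (r : pmap (smash (obj X) (obj Y)) Omega)
    (g : pmap (obj Y) (obj X)) : Prop :=
  r = pcomp (cp K X) (tens_map (pid (obj X)) g).

Definition tame X Y (r : pmap (smash (obj X) (obj Y)) Omega) : Prop :=
  (exists f, is_lower r f) /\ (exists g, is_upper r g).

Lemma cpC X x y : cp K X (tens x y) = cp K X (tens y x).
Proof. by rewrite -{1}(cp_sym K X) pcompE swapE. Qed.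

Lemma is_lowerP X Y (r : pmap (smash (obj X) (obj Y)) Omega) f :
  is_lower r f <-> forall x y, r (tens x y) = cp K Y (tens (f x) y).
Proof.
split=> [<- x y|rE]; first by rewrite pcompE tens_mapE.
by apply: smash_mapP => x y; rewrite pcompE tens_mapE rE.
Qed.

Lemma is_upperP X Y (r : pmap (smash (obj X) (obj Y)) Omega) g :
  is_upper r g <-> forall x y, r (tens x y) = cp K X (tens x (g y)).
Proof.
split=> [-> x y|rE]; first by rewrite pcompE tens_mapE.
by apply: smash_mapP => x y; rewrite pcompE tens_mapE rE.
Qed.

Lemma is_lower_inj X Y (r : pmap (smash (obj X) (obj Y)) Omega) f f' :
  is_lower r f -> is_lower r f' -> f = f'.
Proof. by move=> rf rf'; apply: (cp_inj (s := K)); rewrite [LHS]rf [RHS]rf'. Qed.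

Lemma is_upper_inj X Y (r : pmap (smash (obj X) (obj Y)) Omega) g g' :
  is_upper r g -> is_upper r g' -> g = g'.
Proof.
move=> /is_upperP rg /is_upperP rg'; apply: (cp_inj (s := K)).
by apply: smash_mapP => y x; rewrite !pcompE !tens_mapE /= cpC -rg rg' cpC.
Qed.

Definition tame_hom X Y : Type :=
  {r : pmap (smash (obj X) (obj Y)) Omega | tame r}.

Lemma tame_homP X Y (r s : tame_hom X Y) :
  (forall x y, sval r (tens x y) = sval s (tens x y)) -> r = s.
Proof. by case: r s => [r rt] [s st] rs; apply: eq_exist; apply: smash_mapP. Qed.

Definition lower X Y (r : tame_hom X Y) : pmap (obj X) (obj Y) :=
  projT1 (cid (proj1 (svalP r))).

Definition upper X Y (r : tame_hom X Y) : pmap (obj Y) (obj X) :=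
  projT1 (cid (proj2 (svalP r))).

Lemma lowerP X Y (r : tame_hom X Y) x y :
  sval r (tens x y) = cp K Y (tens (lower r x) y).
Proof. by rewrite /lower; case: cid => f /= /is_lowerP. Qed.

Lemma upperP X Y (r : tame_hom X Y) x y :
  sval r (tens x y) = cp K X (tens x (upper r y)).
Proof. by rewrite /upper; case: cid => g /= /is_upperP. Qed.

Lemma lower_eq X Y (r : tame_hom X Y) (f : pmap (obj X) (obj Y)) :
  (forall x y, sval r (tens x y) = cp K Y (tens (f x) y)) -> lower r = f.
Proof.
move=> /is_lowerP rf; apply: is_lower_inj rf.
by apply/is_lowerP; exact: lowerP.
Qed.

Lemma upper_eq X Y (r : tame_hom X Y) (g : pmap (obj Y) (obj X)) :
  (forall x y, sval r (tens x y) = cp K X (tens x (g y))) -> upper r = g.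
Proof.
move=> /is_upperP rg; apply: is_upper_inj rg.
by apply/is_upperP; exact: upperP.
Qed.

Lemma tame_cp X : tame (cp K X).
Proof. by split; exists (pid _); [apply/is_lowerP|apply/is_upperP]. Qed.

Definition tame_id X : tame_hom X X := exist _ (cp K X) (tame_cp X).

Lemma tame_comp_tame X Y Z (s : tame_hom Y Z) (r : tame_hom X Y) :
  tame (pcomp (sval s) (tens_map (lower r) (pid (obj Z)))).
Proof.
split; [exists (pcomp (lower s) (lower r)); apply/is_lowerP|
        exists (pcomp (upper r) (upper s)); apply/is_upperP] => x z.
  by rewrite pcompE tens_mapE /= lowerP.
by rewrite pcompE tens_mapE /= upperP -lowerP upperP.
Qed.

Definition tame_comp X Y Z (s : tame_hom Y Z) (r : tame_hom X Y) :
  tame_hom X Z := exist _ _ (tame_comp_tame s r).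

Lemma tame_dag_tame X Y (r : tame_hom X Y) :
  tame (pcomp (cp K X) (tens_map (upper r) (pid (obj X)))).
Proof.
split; [exists (upper r); apply/is_lowerP|
        exists (lower r); apply/is_upperP] => y x; rewrite pcompE tens_mapE //=.
by rewrite cpC -upperP lowerP cpC.
Qed.

Definition tame_dag X Y (r : tame_hom X Y) : tame_hom Y X :=
  exist _ _ (tame_dag_tame r).

Lemma lower_id X : lower (tame_id X) = pid _.
Proof. exact: lower_eq. Qed.

Lemma lower_comp X Y Z (s : tame_hom Y Z) (r : tame_hom X Y) :
  lower (tame_comp s r) = pcomp (lower s) (lower r).
Proof. by apply: lower_eq => x z; rewrite [sval _]/= pcompE tens_mapE lowerP. Qed.

Lemma upper_comp X Y Z (s : tame_hom Y Z) (r : tame_hom X Y) :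
  upper (tame_comp s r) = pcomp (upper r) (upper s).
Proof.
by apply: upper_eq => x z; rewrite [sval _]/= pcompE tens_mapE upperP -lowerP upperP.
Qed.

Lemma upper_id X : upper (tame_id X) = pid _.
Proof. exact: upper_eq. Qed.

Lemma lower_dag X Y (r : tame_hom X Y) : lower (tame_dag r) = upper r.
Proof. by apply: lower_eq => y x; rewrite [sval _]/= pcompE tens_mapE. Qed.

Lemma upper_dag X Y (r : tame_hom X Y) : upper (tame_dag r) = lower r.
Proof.
by apply: upper_eq => y x; rewrite [sval _]/= pcompE tens_mapE /= cpC -upperP lowerP cpC.
Qed.

Lemma lower_inj X Y (r s : tame_hom X Y) : lower r = lower s -> r = s.
Proof. by move=> rs; apply: tame_homP => x y; rewrite !lowerP rs. Qed.

Definition TRel : dagger_category ob.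
Proof.
refine (@DaggerCategory ob tame_hom tame_id tame_comp tame_dag _ _ _ _ _ _).
- by move=> X Y f; apply: lower_inj; rewrite lower_comp lower_id; apply: pmapP.
- by move=> X Y f; apply: lower_inj; rewrite lower_comp lower_id; apply: pmapP.
- by move=> X Y Z W h g f; apply: lower_inj; rewrite !lower_comp; apply: pmapP.
- by move=> X; apply: lower_inj; rewrite lower_dag upper_id lower_id.
- move=> X Y Z g f; apply: lower_inj.
  by rewrite lower_dag upper_comp lower_comp !lower_dag.
- by move=> X Y f; apply: lower_inj; rewrite lower_dag upper_dag.
Defined.

End TameRelations.

(* [None] is the base point; [{classic X}] is X with a choice structure, which
   [pointedType] requires. *)
Definition free_pointed (X : Type) : pointedType := option {classic X}.

Definition inF (X : Type) (x : X) : free_pointed X := Some x.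

Definition two : pointedType := free_pointed unit.
Definition two1 : two := inF tt.
Definition two0 : two := point.

(* The pointed map r^ : L(X) (x) L(Y) -> 2 of a relation r. *)
Definition hat_fun (X Y : Type) (r : set (X * Y))
    (w : free_pointed X) (z : free_pointed Y) : two :=
  if `[< exists x y, [/\ w = inF x, z = inF y & r (x, y)] >] then two1 else two0.

Lemma hat_bipointed X Y (r : set (X * Y)) : bipointed (hat_fun r).
Proof. by split => w; rewrite /hat_fun; case: asboolP => // -[x [y []]]. Qed.

Definition hat (X Y : Type) (r : set (X * Y)) :
    pmap (smash (free_pointed X) (free_pointed Y)) two :=
  smash_lift (hat_bipointed r).

Definition rel_of (X Y : Type)
    (t : pmap (smash (free_pointed X) (free_pointed Y)) two) : set (X * Y) :=
  [set xy | t (tens (inF xy.1) (inF xy.2)) = two1].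

Lemma two_dec (b : two) : b = two1 \/ b = two0.
Proof. by case: b => [[]|]; [left|right]. Qed.

Lemma hatP X Y (r : set (X * Y)) w z :
  hat r (tens w z) = two1 <-> exists x y, [/\ w = inF x, z = inF y & r (x, y)].
Proof. by rewrite smash_liftE /hat_fun; case: asboolP. Qed.

Lemma hatK X Y : cancel (@hat X Y) (@rel_of X Y).
Proof.
move=> r; apply/seteqP; split => -[x y]; rewrite /rel_of /=.
  by case/hatP => x' [y' [[->] [->]]].
by move=> rxy; apply/hatP; exists x, y.
Qed.

Lemma rel_ofK X Y : cancel (@rel_of X Y) (@hat X Y).
Proof.
move=> t; apply: smash_mapP => w z; rewrite smash_liftE /hat_fun.
case: asboolP => [[x [y [-> -> /= ->]]] //|nt].
have [t1|-> //] := two_dec (t (tens w z)).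
case: w z => [x|] [y|] in t1 nt *; rewrite ?tens_pointl ?tens_pointr ?pfun_point //.
by case: nt; exists x, y.
Qed.

Definition eq_cp_fun (X : Type) (z z' : free_pointed X) : two :=
  if `[< exists x, z = inF x /\ inF x = z' >] then two1 else two0.

Lemma eq_cp_bipointed X : bipointed (@eq_cp_fun X).
Proof. by split => w; rewrite /eq_cp_fun; case: asboolP => // -[x []]. Qed.

Definition eq_cp (X : Type) :
    pmap (smash (free_pointed X) (free_pointed X)) two :=
  smash_lift (@eq_cp_bipointed X).

Lemma eq_cpP X (z z' : free_pointed X) :
  eq_cp X (tens z z') = two1 <-> exists x, z = inF x /\ inF x = z'.
Proof. by rewrite smash_liftE /eq_cp_fun; case: asboolP. Qed.

Lemma eq_two (b c : two) : (b = two1 <-> c = two1) -> b = c.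
Proof.
case: (two_dec b) => -> [bc cb]; first by rewrite bc.
by case: (two_dec c) => // c1; rewrite c1 cb.
Qed.

Lemma eq_cp_sym X :
  pcomp (eq_cp X) (swap (free_pointed X) (free_pointed X)) = eq_cp X.
Proof.
apply: smash_mapP => z z'; rewrite pcompE swapE; apply: eq_two.
by split=> /eq_cpP[x [-> <-]]; apply/eq_cpP; exists x.
Qed.

Lemma eq_cp_inj (A : pointedType) (X : Type) (f g : pmap A (free_pointed X)) :
  pcomp (eq_cp X) (tens_map f (pid _)) = pcomp (eq_cp X) (tens_map g (pid _)) ->
  f = g.
Proof.
move=> fg; apply: pmapP => a.
have {}fg (x : X) : f a = inF x <-> g a = inF x.
  have := congr1 (fun h : pmap _ _ => h (tens a (inF x))) fg.
  rewrite !pcompE !tens_mapE => E.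
  have cpE (w : free_pointed X) : eq_cp X (tens w (inF x)) = two1 <-> w = inF x.
    by split=> [/eq_cpP[y [-> //]]|->]; apply/eq_cpP; exists x.
  by rewrite -!cpE; move: E; rewrite /pid /= => ->.
case fa: (f a) => [x|]; first by symmetry; apply/fg.
by case ga: (g a) => [x|] //; move: (proj2 (fg x) ga); rewrite fa.
Qed.

Definition eq_cluster : symmetric_cluster two Type :=
  SymmetricCluster eq_cp_sym eq_cp_inj.

Record partial_injection (X Y : Type) (r : set (X * Y)) : Prop :=
  PartialInjection {
  pinj_functional : forall x y y', r (x, y) -> r (x, y') -> y = y';
  pinj_injective : forall x x' y, r (x, y) -> r (x', y) -> x = x' }.

Definition pinj_hom (X Y : Type) : Type :=
  {r : set (X * Y) | partial_injection r}.

Lemma pinj_id_subproof X : partial_injection (@diagonal X).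
Proof. by split => [x y y'|x x' y]; rewrite /diagonal /= => -> ->. Qed.

Definition pinj_id X : pinj_hom X X := exist _ _ (pinj_id_subproof X).

(* [B \; A] is [A] followed by [B]. *)
Lemma pinj_comp_subproof X Y Z (s : pinj_hom Y Z) (r : pinj_hom X Y) :
  partial_injection (sval s \; sval r)%relation.
Proof.
case: r s => [r [rf ri]] [s [sf si]]; split=> [x z z'|x x' z] /=.
  by move=> [y rxy syz] [y' rxy']; rewrite -(rf _ _ _ rxy rxy'); exact: sf.
by move=> [y rxy syz] [y' rxy'] /(si _ _ _ syz) E; rewrite -E in rxy'; exact: ri rxy'.
Qed.

Definition pinj_comp X Y Z (s : pinj_hom Y Z) (r : pinj_hom X Y) :
  pinj_hom X Z := exist _ _ (pinj_comp_subproof s r).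

Lemma pinj_dag_subproof X Y (r : pinj_hom X Y) :
  partial_injection ((sval r)^-1)%relation.
Proof.
by case: r => [r [rf ri]]; split=> [y x x'|y y' x] /=; [exact: ri|exact: rf].
Qed.

Definition pinj_dag X Y (r : pinj_hom X Y) : pinj_hom Y X :=
  exist _ _ (pinj_dag_subproof r).

Lemma pinj_homP X Y (r s : pinj_hom X Y) :
  (forall x y, sval r (x, y) <-> sval s (x, y)) -> r = s.
Proof.
case: r s => [r rP] [s sP] /= rs; apply: eq_exist.
by apply/seteqP; split=> -[x y] /rs.
Qed.

Definition PInj : dagger_category Type.
Proof.
refine (@DaggerCategory Type pinj_hom pinj_id pinj_comp pinj_dag _ _ _ _ _ _).
- move=> X Y f; apply: pinj_homP => x y /=; rewrite /diagonal /=.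
  by split=> [[z fz <-]|fxy] //; exists y.
- move=> X Y f; apply: pinj_homP => x y /=; rewrite /diagonal /=.
  by split=> [[z ->]|fxy] //; exists x.
- move=> X Y Z W h g f; apply: pinj_homP => x y /=; split.
    by move=> [z [t ft gt] hz]; exists t => //; exists z.
  by move=> [t ft [z gt hz]]; exists z => //; exists t.
- by move=> X; apply: pinj_homP => x y; rewrite /= /diagonal /=.
- by move=> X Y Z g f; apply: pinj_homP => x y /=; split=> -[z]; exists z.
- by move=> X Y f; apply: pinj_homP.
Defined.

Definition subset_of (Y : Type) (w : free_pointed Y) : set Y :=
  [set y | w = inF y].

Lemma subset_ofP (Y : Type) (S : set Y) :
  is_subset1 S <-> exists w, S = subset_of w.
Proof.
split=> [S1|[w ->] y y']; last by rewrite /subset_of /= => -> [].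
have [[y Sy]|S0] := pselect (exists y, S y).
  exists (inF y); apply/seteqP; split=> z /=; first by move/(S1 _ _ Sy) ->.
  by case=> <-.
exists point; apply/seteqP; split=> z //= Sz; exfalso; by apply: S0; exists z.
Qed.

(* The function X -> P(Y) associated with r factors through L(Y) -> P(Y). *)
Definition factors_through_free (X Y : Type) (F : X -> set Y) : Prop :=
  exists f : X -> free_pointed Y, F = (@subset_of Y) \o f.

(* Main.v *)
Require Import Defs.
From mathcomp Require Import all_boot all_classical.

(* A pairing into 2 on free pointed sets is determined by its values on pairs
   of proper points, so [t = cp o (f (x) id)] says exactly that [t] is the graph
   of the partial function [f].  Hence tameness is functionality in both
   directions, composition of tame relations is composition of the partial
   functions [r_*], and the dagger exchanges [r_*] and [r^*]. *)

Set Implicit Arguments.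
Unset Strict Implicit.
Unset Printing Implicit Defensive.

Local Open Scope classical_set_scope.

Lemma eq_cp_inFr (X : Type) (w : free_pointed X) (x : X) :
  eq_cp X (tens w (inF x)) = two1 <-> w = inF x.
Proof. by split=> [/eq_cpP[y [-> ->]] //|->]; apply/eq_cpP; exists x. Qed.

Lemma eq_cp_inFl (X : Type) (w : free_pointed X) (x : X) :
  eq_cp X (tens (inF x) w) = two1 <-> w = inF x.
Proof. by split=> [/eq_cpP[y [-> ->]] //|->]; apply/eq_cpP; exists x. Qed.

(** [hat] inverts [rel_of], so a pairing can be recovered from its relation. *)
Lemma free_smash_mapP (X Y : Type)
    (t s : Defs.pmap (smash (free_pointed X) (free_pointed Y)) two) :
  (forall x y, rel_of t (x, y) <-> rel_of s (x, y)) -> t = s.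
Proof.
move=> ts; rewrite -[t]rel_ofK -[s]rel_ofK; congr hat.
by apply/seteqP; split=> -[x y] /ts.
Qed.

Section RelOf.
Variables (X Y : Type).
Implicit Type t : Defs.pmap (smash (free_pointed X) (free_pointed Y)) two.

(** Comparing [f (inF x)] with a proper point [inF y] yields 1 exactly when they are equal. The base
    point in the second argument carries no further condition. *)
Lemma is_lower_relP t (f : Defs.pmap (free_pointed X) (free_pointed Y)) :
  is_lower (K := eq_cluster) t f <->
  forall x y, rel_of t (x, y) <-> f (inF x) = inF y.
Proof.
split=> [/is_lowerP tf x y|tf]; first by rewrite /rel_of /= tf; exact: eq_cp_inFr.
apply: free_smash_mapP => x y; rewrite tf /rel_of /mkset pcompE tens_mapE.
exact: eq_cp_inFr.
Qed.

Lemma is_upper_relP t (g : Defs.pmap (free_pointed Y) (free_pointed X)) :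
  is_upper (K := eq_cluster) t g <->
  forall x y, rel_of t (x, y) <-> g (inF y) = inF x.
Proof.
split=> [/is_upperP tg x y|tg]; first by rewrite /rel_of /= tg; exact: eq_cp_inFl.
apply: free_smash_mapP => x y; rewrite tg /rel_of /mkset pcompE tens_mapE.
by split=> /eq_cp_inFl.
Qed.

End RelOf.

Lemma rel_of_upper (X Y : Type) (t : tame_hom eq_cluster X Y) x y :
  rel_of (sval t) (x, y) <-> upper t (inF y) = inF x.
Proof. by apply: (proj1 (is_upper_relP _ _)); apply/is_upperP; exact: upperP. Qed.

(** The pointed extension given by the universal property of the free pointed set. *)
Definition free_ext (X Y : Type) (f : X -> free_pointed Y) :
    Defs.pmap (free_pointed X) (free_pointed Y) :=
  @PMap (free_pointed X) (free_pointed Y)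
    (fun w => if w is Some x then f x else point) erefl.

Lemma factors_through_freeP (X Y : Type) (F : X -> set Y) :
  factors_through_free F <-> forall x, is_subset1 (F x).
Proof.
split=> [[f ->] x|F1]; first by apply/subset_ofP; exists (f x).
have /choice[f fE] x : exists w, F x = subset_of w by apply/subset_ofP.
by exists f; apply/funext => x /=.
Qed.

(** Puts a factorization into the shape of [is_lower_relP] and [is_upper_relP], by extending
    functions to pointed maps and restricting them back. *)
Lemma factors_through_free_graphP (X Y : Type) (F : X -> set Y) :
  factors_through_free F <->
  exists f : Defs.pmap (free_pointed X) (free_pointed Y),
    forall x y, F x y <-> f (inF x) = inF y.
Proof.
split=> [[f ->]|[f Ff]]; first by exists (free_ext f).
exists (fun x => f (inF x)); apply/funext => x.
by apply/seteqP; split=> y /Ff.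
Qed.

(** Functionality bounds each [xsection] by one element, injectivity each [ysection]. *)
Lemma partial_injection_factors (X Y : Type) (r : set (X * Y)) :
  partial_injection r <->
  factors_through_free (xsection r) /\ factors_through_free (ysection r).
Proof.
rewrite !factors_through_freeP; split=> [[rf ri]|[rf ri]].
  split=> [x y y'|y x x']; rewrite /xsection /ysection /= !inE.
    exact: rf.
  exact: ri.
split=> [x y y' xy xy'|x x' y xy x'y].
  by apply: (rf x); rewrite /xsection /= inE.
by apply: (ri y); rewrite /ysection /= inE.
Qed.

(** A map [r_*] is the same datum as a factorization of [xsection r], and [r^*] as one of
    [ysection r], so the witnesses carry over unchanged. *)
Lemma tame_hatP (X Y : Type) (r : set (X * Y)) :
  tame (K := eq_cluster) (hat r) <-> partial_injection r.
Proof.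
rewrite partial_injection_factors !factors_through_free_graphP.
split=> -[[f rf] [g rg]]; split; [exists f|exists g|exists f|exists g].
- by move=> x y; move/is_lower_relP: rf => <-; rewrite hatK /xsection /= inE.
- by move=> y x; move/is_upper_relP: rg => <-; rewrite hatK /ysection /= inE.
- by apply/is_lower_relP => x y; rewrite -rf hatK /xsection /= inE.
- by apply/is_upper_relP => x y; rewrite -rg hatK /ysection /= inE.
Qed.

Lemma tame_rel_of (X Y : Type) (t : tame_hom eq_cluster X Y) :
  partial_injection (rel_of (sval t)).
Proof. by apply/tame_hatP; rewrite rel_ofK; exact: svalP. Qed.

Definition pinj_of (X Y : Type) (t : hom (TRel eq_cluster) X Y) :
  hom PInj X Y := exist _ _ (tame_rel_of t).

Definition tame_of (X Y : Type) (r : hom PInj X Y) :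
  hom (TRel eq_cluster) X Y := exist _ _ (proj2 (tame_hatP _) (svalP r)).

Lemma pinj_ofK (X Y : Type) : cancel (@pinj_of X Y) (@tame_of X Y).
Proof. by case=> t tP; apply: eq_exist; exact: rel_ofK. Qed.

Lemma tame_ofK (X Y : Type) : cancel (@tame_of X Y) (@pinj_of X Y).
Proof. by case=> r rP; apply: eq_exist; exact: hatK. Qed.

(** Reduces the functor laws to the known values of [lower] on identities, composites and
    daggers. *)
Lemma pinj_of_lower (X Y : Type) (t : hom (TRel eq_cluster) X Y) x y :
  sval (pinj_of t) (x, y) <-> lower t (inF x) = inF y.
Proof. by apply: (proj1 (is_lower_relP _ _)); apply/is_lowerP; exact: lowerP. Qed.

Lemma pinj_of_id (X : Type) : pinj_of (idm (TRel eq_cluster) X) = idm PInj X.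
Proof.
apply: pinj_homP => x y; rewrite pinj_of_lower lower_id /= /diagonal /=.
by split=> [[]|->].
Qed.

Lemma pinj_of_comp (X Y Z : Type) (s : hom (TRel eq_cluster) Y Z)
    (r : hom (TRel eq_cluster) X Y) :
  pinj_of (mcomp (TRel eq_cluster) s r) = mcomp PInj (pinj_of s) (pinj_of r).
Proof.
apply: pinj_homP => x z; rewrite pinj_of_lower lower_comp pcompE.
split=> [|[y /pinj_of_lower -> /pinj_of_lower //]].
(* If [r_*] sends [x] to the base point, so does the composite, which then cannot reach the proper
   point [z]; hence a middle element [y] exists. *)
case rx: (lower r (inF x)) => [y|] sz; last by rewrite pfun_point in sz.
by exists y; apply/pinj_of_lower.
Qed.

Lemma pinj_of_dag (X Y : Type) (t : hom (TRel eq_cluster) X Y) :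
  pinj_of (dag (TRel eq_cluster) t) = dag PInj (pinj_of t).
Proof.
by apply: pinj_homP => y x; rewrite pinj_of_lower lower_dag; split=> /rel_of_upper.
Qed.

Definition pinj_of_functor : dagger_functor (TRel eq_cluster) PInj :=
  DaggerFunctor pinj_of_id pinj_of_comp pinj_of_dag.

Definition tame_of_functor : dagger_functor PInj (TRel eq_cluster).
Proof.
refine (@DaggerFunctor _ PInj (TRel eq_cluster) tame_of _ _ _).
(* Each law for the inverse is checked after applying the injective [pinj_of], which already
   respects the structure. *)
- by move=> X; apply: (can_inj (@pinj_ofK _ _)); rewrite tame_ofK pinj_of_id.
- move=> X Y Z s r; apply: (can_inj (@pinj_ofK _ _)).
  by rewrite pinj_of_comp !tame_ofK.
- move=> X Y r; apply: (can_inj (@pinj_ofK _ _)).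
  by rewrite pinj_of_dag !tame_ofK.
Defined.

Theorem proposition4p3 :
  (exists (F : dagger_functor (TRel eq_cluster) PInj)
          (G : dagger_functor PInj (TRel eq_cluster)),
    [/\ forall (X Y : Type) (t : hom (TRel eq_cluster) X Y),
          sval (fmor F t) = rel_of (sval t),
        forall (X Y : Type) (r : hom PInj X Y),
          sval (fmor G r) = hat (sval r),
        forall (X Y : Type) (t : hom (TRel eq_cluster) X Y),
          fmor G (fmor F t) = t
      & forall (X Y : Type) (r : hom PInj X Y),
          fmor F (fmor G r) = r])
  /\ (forall (X Y : Type) (r : set (X * Y)),
        tame (K := eq_cluster) (hat r) <-> partial_injection r)
  /\ (forall (X Y : Type) (r : set (X * Y)),
        partial_injection r <->
        factors_through_free (xsection r) /\ factors_through_free (ysection r)).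
Proof.
split; last by split; [exact: tame_hatP|exact: partial_injection_factors].
exists pinj_of_functor, tame_of_functor.
by split=> //; [exact: pinj_ofK|exact: tame_ofK].
Qed.
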